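(* Fix $t>0$. For finite sets $X,Y\subset\mathbb{R}^D$, the magnitude distance $d^t_{Mag}(X,Y)=2\,\mathrm{Mag}(t(X\cup Y))-\mathrm{Mag}(tX)-\mathrm{Mag}(tY)$ satisfies: (i) Symmetry: $d^t_{Mag}(X,Y)=d^t_{Mag}(Y,X)$. (ii) Non-negativity: $d^t_{Mag}(X,Y)\ge 0$. (iii) Identity of indiscernibles: $d^t_{Mag}(X,Y)=0$ if and only if $X$ and $Y$ are magnitude-equivalent at scale $t$. (iv) No triangle inequality: for $D>1$, $d^t_{Mag}$ does not satisfy the triangle inequality on finite subsets of $\mathbb{R}^D$.
   Context: For a finite set $A\subset\mathbb{R}^D$ and $t>0$, $tA$ denotes $A$ with the metric $t\|x-y\|$. Its similarity matrix $\zeta_{tA}(x,y)=\exp(-t\|x-y\|)$ ($x,y\in A$) is invertible; the weighting $\mathbf{w}^t_A=\zeta_{tA}^{-1}\mathbb{1}$ is the unique vector with $\sum_{y\in A}\zeta_{tA}(x,y)\mathbf{w}^t_A(y)=1$ for all $x\in A$, and the magnitude is $\mathrm{Mag}(tA)=\sum_{x\in A}\mathbf{w}^t_A(x)$ (with $\mathrm{Mag}(t\emptyset)=0$). Two finite sets $X,Y\subset\mathbb{R}^D$ are magnitude-equivalent at scale $t$ if $\{x\in X:\mathbf{w}^t_X(x)\neq 0\}=\{y\in Y:\mathbf{w}^t_Y(y)\neq0\}$. *)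

(* Defs.v *)
From HB Require Import structures.
From mathcomp Require Import all_boot all_order all_algebra.
From mathcomp Require Import finmap.
From mathcomp Require Import reals sequences exp.
Set Implicit Arguments.
Unset Strict Implicit.
Unset Printing Implicit Defensive.
Import Order.TTheory GRing.Theory Num.Theory.
Local Open Scope ring_scope.
Local Open Scope fset_scope.

Section Magnitude.
Variables (R : realType) (D : nat).
Implicit Types (t : R) (A X Y : {fset 'rV[R]_D}).

Definition enorm (x : 'rV[R]_D) : R := Num.sqrt (\sum_(i < D) x 0 i ^+ 2).

(* similarity matrix of tA, indexed by an enumeration s of A *)
Definition simmx t (s : seq 'rV[R]_D) : 'M[R]_(size s) :=
  \matrix_(i < size s, j < size s) expR (- (t * enorm (s`_i - s`_j))).

Definition weightvec t (s : seq 'rV[R]_D) : 'cV[R]_(size s) :=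
  invmx (simmx t s) *m const_mx 1.

(* the weighting w^t_A, as a function on points (0 outside A) *)
Definition weighting t A (x : 'rV[R]_D) : R :=
  \sum_(i < size (enum_fset A) | (enum_fset A)`_i == x) weightvec t (enum_fset A) i 0.

(* magnitude Mag(tA); the empty sum gives Mag(t emptyset) = 0 *)
Definition Mag t A : R := \sum_(i < size (enum_fset A)) weightvec t (enum_fset A) i 0.

Definition dMag t X Y : R := 2 * Mag t (X `|` Y) - Mag t X - Mag t Y.

Definition mag_equiv t X Y : Prop :=
  [fset x in X | weighting t X x != 0] = [fset y in Y | weighting t Y y != 0].

End Magnitude.

(* Main.v *)
(** The kernel [exp (- t |x - y|)] is strictly positive definite on R^D.
    Gaussians are positive by the exponential series; if [k] is a positive
    kernel with values in [[0, 1]] then [1 - sqrt (1 - k)] is a power series in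
    [k] with nonnegative coefficients, hence positive, so [sqrt (1 - k)] is
    conditionally negative; applied to [exp (- |x - y|^2 / n)] and rescaled,
    this gives in the limit that the Euclidean distance is conditionally
    negative. Strict positivity of its exponential then follows from a moment
    argument.
    For [X] contained in [Z], the energy of [w_Z - w_X] is [Mag Z - Mag X], so
    [dMag X Y] is the sum of the energies of [w_(X u Y) - w_X] and
    [w_(X u Y) - w_Y]; this gives (ii) and (iii). The triangle inequality
    through [Y = X n Z] would be submodularity of the magnitude, which fails on
    a rhombus in the plane. *)
Require Import Defs.
From HB Require Import structures.
From mathcomp Require Import all_boot all_order all_algebra.
From mathcomp Require Import finmap ring lra.
From mathcomp Require Import boolp classical_sets topology normedtype realfun.
From mathcomp Require Import reals sequences exp.
Set Implicit Arguments.
Unset Strict Implicit.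
Unset Printing Implicit Defensive.
Import Order.TTheory GRing.Theory Num.Theory numFieldNormedType.Exports.
Local Open Scope ring_scope.

(** * Positive semidefinite kernels on a finite index set *)

Section Kernels.
Context {R : realType} {I : finType}.
Implicit Types (K L : I -> I -> R) (c d : I -> R).

Definition bform K c d : R := \sum_i \sum_j c i * d j * K i j.

Definition psd K : Prop :=
  (forall i j, K i j = K j i) /\ forall c, 0 <= bform K c c.

Definition cnd K : Prop :=
  forall c, \sum_i c i = 0 -> bform K c c <= 0.

Definition dirac (k : I) : I -> R := fun i => (i == k)%:R.

Lemma sum_dirac k (f : I -> R) : \sum_i dirac k i * f i = f k.
Proof.
rewrite (bigD1 k) //= /dirac eqxx mul1r big1 ?addr0 // => i /negbTE ->.
by rewrite mul0r.
Qed.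

Lemma eq_bform K L c d : (forall i j, K i j = L i j) ->
  bform K c d = bform L c d.
Proof.
by move=> KL; apply: eq_bigr => i _; apply: eq_bigr => j _; rewrite KL.
Qed.

Lemma bform_diracr K c k : bform K c (dirac k) = \sum_i c i * K i k.
Proof.
apply: eq_bigr => i _; rewrite -(sum_dirac k (fun j => c i * K i j)).
by apply: eq_bigr => j _; ring.
Qed.

Lemma bform_dirac K i j : bform K (dirac i) (dirac j) = K i j.
Proof. by rewrite bform_diracr sum_dirac. Qed.

Lemma bformC K c d : (forall i j, K i j = K j i) -> bform K c d = bform K d c.
Proof.
move=> symK; rewrite /bform exchange_big /=.
by apply: eq_bigr => i _; apply: eq_bigr => j _; rewrite symK; ring.
Qed.

Lemma bformDZl K c c' x d :
  bform K (fun i => c i + x * c' i) d = bform K c d + x * bform K c' d.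
Proof.
rewrite /bform mulr_sumr -big_split; apply: eq_bigr => i _ /=.
by rewrite mulr_sumr -big_split; apply: eq_bigr => j _ /=; ring.
Qed.

Lemma bform_sqrDZ K c d x : (forall i j, K i j = K j i) ->
  bform K (fun i => c i + x * d i) (fun i => c i + x * d i) =
  bform K c c + 2 * x * bform K c d + x ^+ 2 * bform K d d.
Proof.
move=> symK; rewrite bformDZl [bform K c _]bformC // [bform K d _]bformC //.
by rewrite !bformDZl [bform K d c]bformC //; ring.
Qed.

Lemma bformDK K L c d :
  bform (fun i j => K i j + L i j) c d = bform K c d + bform L c d.
Proof.
rewrite /bform -big_split; apply: eq_bigr => i _ /=.
by rewrite -big_split; apply: eq_bigr => j _ /=; ring.
Qed.

Lemma bformZK x K c d :
  bform (fun i j => x * K i j) c d = x * bform K c d.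
Proof.
rewrite /bform mulr_sumr; apply: eq_bigr => i _ /=.
by rewrite mulr_sumr; apply: eq_bigr => j _ /=; ring.
Qed.

Lemma bform_rank1 (u v : I -> R) c d :
  bform (fun i j => u i * v j) c d = (\sum_i c i * u i) * (\sum_j d j * v j).
Proof.
rewrite mulr_suml; apply: eq_bigr => i _.
by rewrite mulr_sumr; apply: eq_bigr => j _; ring.
Qed.

Lemma bform_sum J (r : seq J) (F : J -> I -> I -> R) c d :
  bform (fun i j => \sum_(k <- r) F k i j) c d = \sum_(k <- r) bform (F k) c d.
Proof.
elim: r => [|k r IH].
  rewrite big_nil /bform big1 // => i _; rewrite big1 // => j _.
  by rewrite big_nil mulr0.
rewrite big_cons -IH -bformDK.
by apply: eq_bform => i j; rewrite big_cons.
Qed.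

Lemma bform_cvg (K_ : nat -> I -> I -> R) K c d :
  (forall i j, (fun n => K_ n i j) @ \oo --> K i j)%classic ->
  ((fun n => bform (K_ n) c d) @ \oo --> bform K c d)%classic.
Proof.
move=> KK; apply: (cvg_big add_continuous) => i _.
apply: (cvg_big add_continuous) => j _.
by apply: cvgM; [exact: cvg_cst | exact: KK].
Qed.

Lemma psd_diag_ge0 K i : psd K -> 0 <= K i i.
Proof. by case=> _ posK; rewrite -(bform_dirac K) posK. Qed.

Lemma psd_diag0 K i j : psd K -> K i i = 0 -> K i j = 0.
Proof.
move=> [symK posK] Ki0.
have [//|nz] := eqVneq (K i j) 0.
(* With [K i i = 0] the form at [dirac j + x * dirac i] is affine in [x]; this [x] gives it the
   value -1. *)
pose x := - (1 + K j j) / (2 * K i j).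
have := posK (fun k => dirac j k + x * dirac i k).
rewrite bform_sqrDZ // !bform_dirac Ki0 mulr0 addr0 (symK j i).
suff -> : 2 * x * K i j = - (1 + K j j) by lra.
by rewrite /x; field.
Qed.

Lemma gram_psd K (s : seq (I -> R)) :
  (forall i j, K i j = \sum_(v <- s) v i * v j) -> psd K.
Proof.
move=> KE; split=> [i j|c].
  by rewrite !KE; apply: eq_bigr => v _; rewrite mulrC.
rewrite (eq_bform _ _ KE) bform_sum; apply: sumr_ge0 => v _.
by rewrite bform_rank1 -expr2 sqr_ge0.
Qed.

(* Cholesky elimination: subtracting the rank-one kernel of a column with
   positive diagonal entry keeps the kernel positive and clears that entry. *)
Lemma psd_gram K : psd K ->
  exists s : seq (I -> R), forall i j, K i j = \sum_(v <- s) v i * v j.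
Proof.
move: {2}#|_| (leqnn #|[pred i | K i i != 0]|) => n.
elim: n K => [|n IH] K le_n psdK.
  exists [::] => i j; rewrite big_nil; apply: psd_diag0 => //.
  move: le_n; rewrite leqn0 => /eqP/card0_eq/(_ i).
  by rewrite !inE => /negbFE/eqP.
have [/existsP[k nzk]|/existsPn z] := boolP [exists k, K k k != 0]; last first.
  apply: IH => //; rewrite eq_card0 // => i.
  by rewrite !inE; apply/negbTE/z.
have pk : 0 < K k k by rewrite lt_def nzk psd_diag_ge0.
have [symK posK] := psdK.
pose v i := K i k / Num.sqrt (K k k).
have vv i j : v i * v j = K i k * K j k / K k k.
  rewrite /v -[in RHS](sqr_sqrtr (ltW pk)).
  by field; rewrite gt_eqF // sqrtr_gt0.
pose L i j := K i j - v i * v j.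
have psdL : psd L.
  split=> [i j|c]; first by rewrite /L symK mulrC.
  have bE : bform K c (dirac k) = \sum_i c i * K i k by rewrite bform_diracr.
  have -> : bform L c c = bform K c c - (bform K c (dirac k)) ^+ 2 / K k k.
    transitivity (bform K c c + -1 / K k k *
                    bform (fun i j => K i k * K j k) c c).
      rewrite -bformZK -bformDK; apply: eq_bform => i j.
      by rewrite /L vv; field.
    by rewrite bform_rank1 -bE; field.
  (* This multiple of [dirac k] minimizes the form of [K] on the line through [c], and the minimum
     is the form of [L] at [c]. *)
  have := posK (fun i => c i + (- bform K c (dirac k) / K k k) * dirac k i).
  rewrite bform_sqrDZ // bform_dirac.
  by congr (0 <= _); field.
have [|s sE] := IH L _ psdL.
  rewrite -ltnS; apply: leq_trans le_n; apply: proper_card; apply/properP.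
  split.
    apply/fintype.subsetP => i; rewrite !inE; apply: contra_neq => Ki0.
    by rewrite /L vv (psd_diag0 k psdK) // Ki0 !mul0r subr0.
  exists k; rewrite !inE // /L vv mulfK ?subrr ?eqxx //.
exists (v :: s) => i j; rewrite big_cons -sE /L; ring.
Qed.

(** In Gram form the quadratic form is a sum of squares of pairings of [c] with the Gram vectors.
    All of them vanish, and each row of [K] pairs with [c] as a combination of them. *)
Lemma psd_ker K c : psd K -> bform K c c = 0 ->
  forall i, \sum_j c j * K i j = 0.
Proof.
move=> /psd_gram[s KE]; rewrite (eq_bform _ _ KE) bform_sum => Q0 i.
have z : all (fun v => \sum_j c j * v j == 0) s.
  elim: s {KE} Q0 => //= v s IH; rewrite big_cons bform_rank1 -expr2 => Q0.
  have S0 : 0 <= \sum_(w <- s) bform (fun i j => w i * w j) c c.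
    by apply: sumr_ge0 => w _; rewrite bform_rank1 -expr2 sqr_ge0.
  have V0 : 0 <= (\sum_j c j * v j) ^+ 2 by exact: sqr_ge0.
  rewrite IH; last by lra.
  by rewrite andbT -sqrf_eq0; apply/eqP; lra.
transitivity (\sum_(v <- s) v i * \sum_j c j * v j).
  under eq_bigr => j _ do rewrite KE mulr_sumr.
  rewrite exchange_big; apply: eq_bigr => v _ /=.
  by rewrite mulr_sumr; apply: eq_bigr => j _; ring.
elim: s {KE Q0} z => [|v s IH] /=; first by rewrite big_nil.
by case/andP => /eqP v0 /IH IHs; rewrite big_cons IHs v0 mulr0 addr0.
Qed.

(** Schur product theorem: pointwise products of Gram vectors are Gram vectors of the product. *)
Lemma psdM K L : psd K -> psd L -> psd (fun i j => K i j * L i j).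
Proof.
move=> /psd_gram[s KE] /psd_gram[r LE].
apply: (@gram_psd _ [seq (fun i => v i * w i) | v <- s, w <- r]) => i j.
rewrite big_allpairs_dep KE LE mulr_suml; apply: eq_bigr => v _.
by rewrite mulr_sumr; apply: eq_bigr => w _; ring.
Qed.

Lemma psdD K L : psd K -> psd L -> psd (fun i j => K i j + L i j).
Proof.
move=> [sK pK] [sL pL]; split=> [i j|c]; first by rewrite sK sL.
by rewrite bformDK addr_ge0.
Qed.

Lemma psdZ x K : 0 <= x -> psd K -> psd (fun i j => x * K i j).
Proof.
move=> x0 [sK pK]; split=> [i j|c]; first by rewrite sK.
by rewrite bformZK mulr_ge0.
Qed.

Lemma psd_rank1 (u : I -> R) : psd (fun i j => u i * u j).
Proof. by apply: (@gram_psd _ [:: u]) => i j; rewrite big_seq1. Qed.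

Lemma psd_eq K L : (forall i j, K i j = L i j) -> psd K -> psd L.
Proof.
by move=> KL; have -> : L = K by apply/funext => i; apply/funext => j.
Qed.

Lemma psdX n K : psd K -> psd (fun i j => K i j ^+ n).
Proof.
move=> pK; elim: n => [|n IH].
  by apply: psd_eq (psd_rank1 (fun=> 1)) => i j; rewrite mulr1 expr0.
by apply: psd_eq (psdM pK IH) => i j; rewrite exprS.
Qed.

Lemma psd_cvg (K_ : nat -> I -> I -> R) K :
  (forall n, psd (K_ n)) ->
  (forall i j, (fun n => K_ n i j) @ \oo --> K i j)%classic -> psd K.
Proof.
move=> pK KK; split=> [i j|c].
  have := KK j i.
  under eq_fun => n do rewrite (pK n).1.
  by move=> KK'; apply: (cvg_unique _ (KK i j) KK'); exact: norm_hausdorff.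
have cQ := @bform_cvg _ _ c c KK; apply: (cvgr_to_ge cQ).
by apply: nearW => n; exact: (pK n).2.
Qed.

(* Every term of the exponential series has a nonnegative quadratic form, so
   each one is a lower bound; this is what later yields strict positivity. *)
Lemma bform_expR_ge K n c : psd K ->
  bform (fun i j => K i j ^+ n) c c / n`!%:R
    <= bform (fun i j => expR (K i j)) c c.
Proof.
move=> pK.
pose E N i j := \sum_(0 <= k < N) K i j ^+ k / k`!%:R.
have EE i j : ((fun N => E N i j) @ \oo --> expR (K i j))%classic.
  exact: is_cvg_series_exp_coeff.
have cQ := @bform_cvg _ _ c c EE; apply: (cvgr_to_ge cQ).
exists n.+1 => // N /= ltnN.
rewrite /E bform_sum (big_cat_nat (leq0n n) (ltnW ltnN)) /=.
have tE k : bform (fun i j => K i j ^+ k / k`!%:R) c c =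
            bform (fun i j => K i j ^+ k) c c / k`!%:R.
  by rewrite mulrC -bformZK; apply: eq_bform => i j; rewrite mulrC.
have pos k : 0 <= bform (fun i j => K i j ^+ k / k`!%:R) c c.
  by rewrite tE divr_ge0 // (psdX k pK).2.
rewrite [X in _ <= _ + X]big_ltn // tE addrCA lerDl.
by rewrite addr_ge0 // sumr_ge0.
Qed.

Lemma psd_expR K : psd K -> psd (fun i j => expR (K i j)).
Proof.
move=> pK; split=> [i j|c]; first by rewrite pK.1.
by apply: le_trans (bform_expR_ge 0 c pK); rewrite divr_ge0 // (psdX 0 pK).2.
Qed.

End Kernels.

(** * Polynomial approximation of [1 - sqrt (1 - k)] *)

Section SquareRoot.
Context {R : realType}.

(* Weierstrass iteration for [1 - sqrt (1 - k)]: its iterates are polynomials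
   in [k] with nonnegative coefficients. *)
Fixpoint sqrt_iter (n : nat) (k : R) : R :=
  if n is m.+1 then (k + sqrt_iter m k ^+ 2) / 2 else 0.

(** The limit [1 - y] is a fixed point, and the error obeys [e' = e * (1 - y - e / 2) <= e * (1 - e
    / 2)]. The map [x * (1 - x / 2)] is increasing on [[0, 1]] and sends [2 / a] below
    [2 / (a + 1)], whence a rate that is uniform in [k], including [k = 1]. *)
Lemma sqrt_iter_bound n (k : R) : 0 <= k <= 1 ->
  [/\ 0 <= sqrt_iter n k, sqrt_iter n k <= 1 - Num.sqrt (1 - k) &
      1 - Num.sqrt (1 - k) - 2 / n.+2%:R <= sqrt_iter n k].
Proof.
move=> /andP[k0 k1]; set y := Num.sqrt _.
have y0 : 0 <= y by exact: sqrtr_ge0.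
have yE : y ^+ 2 = 1 - k by rewrite sqr_sqrtr // subr_ge0.
have y1 : y <= 1 by nra.
elim: n => [|n [z0 zu zl]] /=.
  by rewrite divff ?pnatr_eq0 //; split; lra.
set z := sqrt_iter n k in z0 zu zl *.
split; [by nra|by nra|].
set a : R := n.+2%:R in zl *; rewrite -(natr1 n.+2) -/a.
have a2 : 2 <= a by rewrite /a ler_nat.
pose e := 1 - y - z.
pose b := 2 / a.
have ab : a * b = 2 by rewrite /b mulrC divfK //; lra.
have b0 : 0 < b by rewrite divr_gt0 //; lra.
have b1 : b <= 1 by nra.
have e0 : 0 <= e by rewrite /e; lra.
have eb : e <= b by rewrite /e; move: zl; rewrite -/b; lra.
have step : 1 - y - (k + z ^+ 2) / 2 <= e * (1 - e / 2).
  by have := mulr_ge0 e0 y0; rewrite /e; lra.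
have mono : e * (1 - e / 2) <= b * (1 - b / 2).
  have : 0 <= (b - e) * (1 - (b + e) / 2) by apply: mulr_ge0; lra.
  by lra.
suff last : b * (1 - b / 2) <= 2 / (a + 1) by lra.
rewrite ler_pdivlMr; last by lra.
have -> : b * (1 - b / 2) * (a + 1) = (a * b + b) * (1 - b / 2) by ring.
by rewrite ab; nra.
Qed.

Lemma sqrt_iter_cvg (k : R) : 0 <= k <= 1 ->
  ((fun n => sqrt_iter n k) @ \oo --> 1 - Num.sqrt (1 - k))%classic.
Proof.
move=> k01; set l := 1 - _.
apply: (@squeeze_cvgr _ _ _ _ (fun n => l - 2 * harmonic n) (fun=> l)).
- apply: nearW => n; have [_ -> lo] := sqrt_iter_bound n k01.
  rewrite andbT; apply: le_trans lo; rewrite lerD2l lerN2 ler_pM2l //.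
  by rewrite /harmonic /= lef_pV2 ?posrE ?ltr0n // ler_nat.
- rewrite -[X in (_ --> X)%classic]subr0 -[X in (_ --> _ - X)%classic](mulr0 2).
  apply: cvgB; first exact: cvg_cst.
  by apply: cvgM; [exact: cvg_cst | exact: cvg_harmonic].
- exact: cvg_cst.
Qed.

End SquareRoot.

(** * Conditionally negative kernels and their exponentials *)

Section NegativeType.
Context {R : realType} {I : finType}.
Implicit Types (K d : I -> I -> R).

(** On vectors of sum zero the constant kernel 1 has zero form, so positivity of [1 - sqrt (1 - K)]
    turns into negativity of the root. *)
Lemma cnd_sqrt_1B K : psd K -> (forall i j, 0 <= K i j <= 1) ->
  cnd (fun i j => Num.sqrt (1 - K i j)).
Proof.
move=> pK K01 c c0.
have [_ /(_ c)] : psd (fun i j => 1 - Num.sqrt (1 - K i j)).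
  apply: (@psd_cvg _ _ (fun n i j => sqrt_iter n (K i j))).
    elim=> [|n IH] /=.
      by apply: (@gram_psd _ _ _ [::]) => i j; rewrite big_nil.
    have h0 : 0 <= 2^-1 :> R by rewrite invr_ge0.
    by apply: psd_eq (psdZ h0 (psdD pK (psdX 2 IH))) => i j; rewrite mulrC.
  by move=> i j; exact: sqrt_iter_cvg.
have -> : bform (fun i j => 1 - Num.sqrt (1 - K i j)) c c =
   bform (fun i j => 1 * 1) c c + -1 * bform (fun i j => Num.sqrt (1 - K i j)) c c.
  by rewrite -bformZK -bformDK; apply: eq_bform => i j; ring.
rewrite (bform_rank1 (fun=> 1) (fun=> 1)).
under eq_bigr do rewrite mulr1.
by rewrite c0; lra.
Qed.

Lemma cndZ x d : 0 <= x -> cnd d -> cnd (fun i j => x * d i j).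
Proof. by move=> x0 nd c c0; rewrite bformZK mulr_ge0_le0 // nd. Qed.

Lemma cnd_cvg (d_ : nat -> I -> I -> R) d : (forall n, cnd (d_ n)) ->
  (forall i j, (fun n => d_ n i j) @ \oo --> d i j)%classic -> cnd d.
Proof.
move=> nd dd c c0; have cQ := @bform_cvg _ _ _ _ c c dd.
by apply: (cvgr_to_le cQ); apply: nearW => n; exact: nd.
Qed.

(* Moment argument: the vanishing of every form [K ^+ n] makes each row of [K]
   annihilate all polynomials, so the level sets of a row have mass zero; at a
   support point farthest from [o] that level set is a single point. *)
Lemma expRN_posdef d (t : R) (c : I -> R) : 0 < t ->
  (forall i j, d i j = d j i) -> (forall i j, 0 <= d i j) ->
  (forall i j, d i j = 0 <-> i = j) -> cnd d ->
  0 <= bform (fun i j => expR (- (t * d i j))) c c /\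
  (bform (fun i j => expR (- (t * d i j))) c c = 0 -> forall i, c i = 0).
Proof.
move=> t0 symd d0 dE nd.
have [o _|I0] := pickP I; last first.
  split; last by move=> _ i; have := I0 i.
  by rewrite /bform big_pred0.
have dii i : d i i = 0 by apply/dE.
(* Twice the Gromov product based at [o]. Its form at [b] is minus the form of [d] at [b] with the
   mass [- S] added at [o], a vector of sum zero. *)
pose K i j := d i o + d j o - d i j.
have psdK : psd K.
  split=> [i j|b]; first by rewrite /K (symd i j); ring.
  pose S := \sum_i b i.
  have : bform d (fun i => b i + (- S) * dirac o i)
                 (fun i => b i + (- S) * dirac o i) <= 0.
    apply: nd; rewrite big_split /= -/S -mulr_sumr.
    under [X in _ * X]eq_bigr do rewrite -[dirac o _]mulr1.
    by rewrite sum_dirac mulr1 subrr.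
  rewrite bform_sqrDZ // bform_dirac dii mulr0 addr0 bform_diracr.
  have -> : bform K b b = bform (fun i j => d i o * 1) b b +
     (bform (fun i j => 1 * d j o) b b + -1 * bform d b b).
    by rewrite -bformZK -!bformDK; apply: eq_bform => i j; rewrite /K; ring.
  rewrite (bform_rank1 (fun i => d i o) (fun=> 1)).
  rewrite (bform_rank1 (fun=> 1) (fun j => d j o)).
  have -> : \sum_i b i * 1 = S by apply: eq_bigr => i _; rewrite mulr1.
  by set X := \sum_i _; lra.
have psdtK : psd (fun i j => t * K i j) by apply: psdZ => //; exact: ltW.
(* Since [- d i j = K i j - d i o - d j o], the factors that depend on one index alone are absorbed
   into the vector. *)
pose b i := c i * expR (- (t * d i o)).
have bE : bform (fun i j => expR (- (t * d i j))) c c =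
          bform (fun i j => expR (t * K i j)) b b.
  apply: eq_bigr => i _; apply: eq_bigr => j _.
  rewrite (_ : - (t * d i j) = - (t * d i o) + (- (t * d j o) + t * K i j)).
    by rewrite !expRD /b; ring.
  by rewrite /K; ring.
rewrite bE; split; first exact: (psd_expR psdtK).2.
move=> Q0.
have mom n i : \sum_j b j * (t * K i j) ^+ n = 0.
  have pn := psdX n psdtK.
  apply: (psd_ker pn); apply/eqP; rewrite eq_le pn.2 andbT.
  have := bform_expR_ge n b psdtK; rewrite Q0.
  by rewrite pmulr_lle0 // invr_gt0 ltr0n fact_gt0.
have momp (p : {poly R}) i : \sum_j b j * p.[t * K i j] = 0.
  under eq_bigr => j _ do rewrite horner_coef mulr_sumr.
  rewrite exchange_big big1 //= => n _.
  transitivity (p`_n * \sum_j b j * (t * K i j) ^+ n); last by rewrite mom mulr0.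
  by rewrite mulr_sumr; apply: eq_bigr => j _; ring.
have [/existsP[i1 nz1]|/existsPn z] := boolP [exists i, c i != 0]; last first.
  by move=> i; apply/eqP/negbNE/z.
have [i nzi maxi] := @arg_maxP _ _ _ i1 (fun i => c i != 0) (fun i => d i o) nz1.
(* As [K i i = 2 * d i o], equality means [d i j = d j o - d i o], which is at most 0 because [i] is
   farthest from [o]. *)
have lvl j : c j != 0 -> K i j = K i i -> j = i.
  move=> /maxi le_ji; have {}le_ji : d j o <= d i o by [].
  rewrite /K dii => E.
  by apply/esym/dE/eqP; rewrite eq_le d0 andbT; lra.
(* This polynomial vanishes at every value of row [i] except [t * K i i], so only the term of [i]
   survives in the moment identity. *)
pose p := \prod_(j | K i j != K i i) ('X - (t * K i j)%:P).
have pE x : p.[x] = \prod_(j | K i j != K i i) (x - t * K i j).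
  by rewrite horner_prod; apply: eq_bigr => j _; rewrite !hornerE.
have := momp p i; rewrite (bigD1 i) //= big1 ?addr0.
  move/eqP; rewrite /b !mulf_eq0 (negbTE nzi) gt_eqF ?expR_gt0 //= pE.
  case/prodf_eq0 => j nj; rewrite -mulrBr mulf_eq0 gt_eqF //= subr_eq0.
  by rewrite eq_sym (negbTE nj).
move=> j ji; have [cj|nzj] := eqVneq (c j) 0; first by rewrite /b cj !mul0r.
rewrite pE (bigD1 j) /= ?subrr ?mul0r ?mulr0 //.
by apply/eqP => /(lvl _ nzj) E; rewrite E eqxx in ji.
Qed.

End NegativeType.

(** * The Euclidean distance is conditionally negative *)

Section Euclidean.
Context {R : realType} {D : nat}.
Implicit Types (x y : 'rV[R]_D).

Lemma enorm_ge0 x : 0 <= enorm x.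
Proof. exact: sqrtr_ge0. Qed.

Lemma enorm_sqr x : enorm x ^+ 2 = \sum_i x 0 i ^+ 2.
Proof. by rewrite sqr_sqrtr // sumr_ge0 // => i _; exact: sqr_ge0. Qed.

Lemma enormBC x y : enorm (x - y) = enorm (y - x).
Proof.
rewrite /enorm; congr Num.sqrt; apply: eq_bigr => i _.
by rewrite !mxE; ring.
Qed.

Lemma enormB_eq0 x y : enorm (x - y) = 0 <-> x = y.
Proof.
split=> [E|->]; last first.
  rewrite /enorm big1 ?sqrtr0 // => i _.
  by rewrite subrr mxE expr0n.
apply/rowP => i; apply/eqP; rewrite -subr_eq0 -sqrf_eq0; apply/eqP.
have := enorm_sqr (x - y); rewrite E expr0n /= => /esym/psumr_eq0P H.
by rewrite -[RHS](H _ i) // ?mxE // => j _; exact: sqr_ge0.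
Qed.

(** Expanding the squared norm factors the Gaussian into a rank-one kernel and the exponential of a
    multiple of the Gram kernel. *)
Lemma psd_gaussian (I : finType) (p : I -> 'rV[R]_D) (s : R) : 0 <= s ->
  psd (fun i j => expR (- (s * enorm (p i - p j) ^+ 2))).
Proof.
move=> s0.
have gram : psd (fun i j => \sum_k p i 0 k * p j 0 k).
  apply: (@gram_psd _ _ _ [seq (fun i => p i 0 k) | k <- enum 'I_D]) => i j.
  by rewrite big_map big_enum.
have p2s : psd (fun i j => 2 * s * \sum_k p i 0 k * p j 0 k).
  by apply: psdZ gram; rewrite mulr_ge0.
apply: psd_eq (psdM (psd_rank1 (fun i => expR (- (s * enorm (p i) ^+ 2))))
                 (psd_expR p2s)) => i j.
rewrite -!expRD; congr expR; rewrite !enorm_sqr.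
have -> : \sum_k (p i - p j) 0 k ^+ 2 = \sum_k p i 0 k ^+ 2 +
    (\sum_k p j 0 k ^+ 2 + -2 * \sum_k p i 0 k * p j 0 k).
  rewrite mulr_sumr -!big_split; apply: eq_bigr => k _ /=.
  by rewrite !mxE; ring.
by ring.
Qed.

(** With [v = u / (n + 1)], the bounds [v - v ^+ 2 <= 1 - expR (- v) <= v] squeeze the sequence; the
    left one comes from [expR (- v) <= 1 / (1 + v)]. *)
Lemma cvg_harmonic_expR (u : R) : 0 <= u ->
  ((fun n => n.+1%:R * (1 - expR (- (harmonic n * u)))) @ \oo --> u)%classic.
Proof.
move=> u0.
apply: (@squeeze_cvgr _ _ _ _ (fun n => u - u ^+ 2 * harmonic n) (fun=> u)).
- apply: nearW => n; set a : R := n.+1%:R; rewrite /harmonic /= -/a.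
  have a0 : 0 < a by rewrite ltr0n.
  set v := a^-1 * u; have v0 : 0 <= v by rewrite mulr_ge0 // invr_ge0 ltW.
  have uE : u = a * v by rewrite /v mulVKf // gt_eqF.
  have -> : u ^+ 2 / a = a * v ^+ 2.
    by rewrite uE; field; rewrite nat1r pnatr_eq0.
  have lo := expR_ge1Dx (- v).
  have up : expR (- v) * (1 + v) <= 1.
    rewrite [leRHS](_ : 1 = expR (- v) * expR v); last by rewrite -expRD addNr expR0.
    by apply: ler_wpM2l; rewrite ?expR_ge0 // expR_ge1Dx.
  have e0 := expR_ge0 (- v).
  rewrite {1 2}uE -mulrBr !ler_pM2l //.
  by apply/andP; split; nra.
- rewrite -[X in (_ --> X)%classic]subr0.
  rewrite -[X in (_ --> _ - X)%classic](mulr0 (u ^+ 2)).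
  apply: cvgB; first exact: cvg_cst.
  by apply: cvgM; [exact: cvg_cst | exact: cvg_harmonic].
- exact: cvg_cst.
Qed.

Lemma cnd_enorm (I : finType) (p : I -> 'rV[R]_D) :
  cnd (fun i j => enorm (p i - p j)).
Proof.
pose g n i j := Num.sqrt n.+1%:R *
  Num.sqrt (1 - expR (- (harmonic n * enorm (p i - p j) ^+ 2))).
apply: (@cnd_cvg _ _ g) => [n|i j].
  apply: cndZ; first exact: sqrtr_ge0.
  have h0 : 0 <= harmonic n :> R by rewrite invr_ge0 ler0n.
  apply: cnd_sqrt_1B (psd_gaussian p h0) _ => i j.
  by rewrite expR_ge0 expR_le1 oppr_le0 mulr_ge0 // sqr_ge0.
rewrite -[X in (_ --> X)%classic]ger0_norm ?enorm_ge0 // -sqrtr_sqr.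
under eq_fun do rewrite /g -sqrtrM ?ler0n //.
apply: (@continuous_cvg _ _ _ _ _ _ Num.sqrt); first exact: sqrt_continuous.
by apply: cvg_harmonic_expR; exact: sqr_ge0.
Qed.

Lemma simkernel_posdef (I : finType) (p : I -> 'rV[R]_D) (t : R) c :
  0 < t -> injective p ->
  0 <= bform (fun i j => expR (- (t * enorm (p i - p j)))) c c /\
  (bform (fun i j => expR (- (t * enorm (p i - p j)))) c c = 0 ->
     forall i, c i = 0).
Proof.
move=> t0 injp; apply: expRN_posdef => //.
- by move=> i j; exact: enormBC.
- by move=> i j; exact: enorm_ge0.
- by move=> i j; split=> [/enormB_eq0/injp|->] //; apply/enormB_eq0.
- exact: cnd_enorm.
Qed.

End Euclidean.

(** * Weightings and the monotonicity of magnitude *)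

Section Magnitude.
Context {R : realType} {D : nat} (t : R) (t_gt0 : 0 < t).
Implicit Types (A X Y Z : {fset 'rV[R]_D}) (w c : 'rV[R]_D -> R).
Implicit Types (x y : 'rV[R]_D).

Definition sim x y : R := expR (- (t * enorm (x - y))).

Lemma simC x y : sim x y = sim y x.
Proof. by rewrite /sim enormBC. Qed.

Lemma sim_diag x : sim x x = 1.
Proof.
by have /enormB_eq0 e0 := erefl x; rewrite /sim e0 mulr0 oppr0 expR0.
Qed.

(** The weighting equations without matrices or enumerations, so that one function can be tested on
    several sets and explicit solutions can be checked. *)
Definition is_weighting A w : Prop :=
  forall x, x \in A -> \sum_(y <- A) sim x y * w y = 1.

Lemma sim_posdef A c :
  0 <= \sum_(x <- A) c x * \sum_(y <- A) sim x y * c y /\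
  (\sum_(x <- A) c x * \sum_(y <- A) sim x y * c y = 0 ->
     forall x, x \in A -> c x = 0).
Proof.
have [] := simkernel_posdef (fun i : A => c (val i)) t_gt0 (@val_inj _ _ A).
have -> : bform (fun i j : A => expR (- (t * enorm (val i - val j))))
            (fun i => c (val i)) (fun i => c (val i)) =
          \sum_(x <- A) c x * \sum_(y <- A) sim x y * c y.
  rewrite big_seq_fsetE; apply: eq_bigr => i _ /=.
  rewrite big_seq_fsetE mulr_sumr; apply: eq_bigr => j _ /=.
  by rewrite /sim; ring.
move=> Q0 QE; split=> // /QE z x xA.
exact: (z [` xA]%fset).
Qed.

(** A vector in the left kernel has zero quadratic form, hence is zero by strict positivity. *)
Lemma simmx_unit (s : seq 'rV[R]_D) : uniq s -> simmx t s \in unitmx.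
Proof.
move=> us; rewrite -row_free_unit; apply: inj_row_free => v v0.
have injs : injective (fun i : 'I_(size s) => s`_i).
  by move=> i j /eqP; rewrite nth_uniq // => /eqP/val_inj.
have [_ QE] := simkernel_posdef (fun i => v 0 i) t_gt0 injs.
apply/rowP => i; rewrite [RHS]mxE; apply: QE.
transitivity (\sum_j (v *m simmx t s) 0 j * v 0 j).
  rewrite /bform exchange_big; apply: eq_bigr => j _ /=.
  rewrite !mxE mulr_suml; apply: eq_bigr => k _.
  by rewrite !mxE; ring.
by rewrite v0 big1 // => j _; rewrite mxE mul0r.
Qed.

Lemma weighting_nth A (i : 'I_(size (enum_fset A))) :
  weighting t A (enum_fset A)`_i = weightvec t (enum_fset A) i 0.
Proof.
rewrite /weighting (bigD1 i) //= big1 ?addr0 // => j /andP[/eqP E /eqP[]].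
apply/val_inj/eqP.
by rewrite -(nth_uniq 0 (ltn_ord j) (ltn_ord i) (fset_uniq A)) E.
Qed.

Lemma weighting_out A x : x \notin A -> weighting t A x = 0.
Proof.
move=> xA; rewrite /weighting big_pred0 // => i; apply/negbTE.
by apply: contraNneq xA => <-; exact: mem_nth.
Qed.

Lemma big_enum_fset A (F : 'rV[R]_D -> R) :
  \sum_(y <- A) F y = \sum_(i < size (enum_fset A)) F (enum_fset A)`_i.
Proof. by rewrite (big_nth 0) big_mkord. Qed.

Lemma weightingP A : is_weighting A (weighting t A).
Proof.
move=> x xA; pose s := enum_fset A; rewrite big_enum_fset.
have ix : (index x s < size s)%N by rewrite index_mem.
have /matrixP/(_ (Ordinal ix) 0) : simmx t s *m weightvec t s = const_mx 1.
  by rewrite /weightvec mulKVmx // simmx_unit // fset_uniq.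
rewrite !mxE => <-; apply: eq_bigr => i _.
by rewrite weighting_nth !mxE /= nth_index.
Qed.

Lemma weighting_uniq A w x : is_weighting A w -> x \in A ->
  w x = weighting t A x.
Proof.
move=> wP xA; apply/eqP; rewrite -subr_eq0; apply/eqP.
have [_ QE] := sim_posdef A (fun x => w x - weighting t A x).
apply: (QE _ _ xA); rewrite big_seq big1 // => y yA.
have -> : \sum_(z <- A) sim y z * (w z - weighting t A z) =
    \sum_(z <- A) sim y z * w z - \sum_(z <- A) sim y z * weighting t A z.
  by rewrite -sumrB; apply: eq_bigr => z _; ring.
by rewrite wP // weightingP // subrr mulr0.
Qed.

Lemma MagE A : Mag t A = \sum_(x <- A) weighting t A x.
Proof.
by rewrite big_enum_fset; apply: eq_bigr => i _; rewrite weighting_nth.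
Qed.

Lemma is_weighting_Mag A w : is_weighting A w -> Mag t A = \sum_(x <- A) w x.
Proof.
move=> wP; rewrite MagE big_seq [RHS]big_seq; apply: eq_bigr => x xA.
by rewrite (weighting_uniq wP).
Qed.

Lemma sum_weighting_sub X Z (F : 'rV[R]_D -> R) : (X `<=` Z)%fset ->
  \sum_(y <- Z) F y * weighting t X y = \sum_(y <- X) F y * weighting t X y.
Proof.
move=> XZ; apply/esym/big_fset_incl => // x _ xX.
by rewrite weighting_out // mulr0.
Qed.

(** Let [h] be the potential on [Z] of [w_X] extended by zero. The potential of [c] is [1 - h],
    which vanishes on [X] and so pairs to zero with [w_X]; by symmetry of [sim], [w_Z] pairs with
    [h] to [Mag X]. *)
Lemma Mag_subE X Z (c := fun x => weighting t Z x - weighting t X x) :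
  (X `<=` Z)%fset ->
  Mag t Z - Mag t X = \sum_(x <- Z) c x * \sum_(y <- Z) sim x y * c y.
Proof.
move=> XZ.
pose h x := \sum_(y <- Z) sim x y * weighting t X y.
have hX x : x \in X -> h x = 1.
  by move=> xX; rewrite /h sum_weighting_sub // weightingP.
have PE x : x \in Z -> \sum_(y <- Z) sim x y * c y = 1 - h x.
  move=> xZ; rewrite -(weightingP xZ) /h -sumrB.
  by apply: eq_bigr => y _; rewrite /c; ring.
transitivity (\sum_(x <- Z) c x * (1 - h x)); last first.
  rewrite big_seq [RHS]big_seq; apply: eq_bigr => x xZ.
  by rewrite PE.
have X0 : \sum_(x <- Z) (1 - h x) * weighting t X x = 0.
  rewrite sum_weighting_sub // big_seq big1 // => x xX.
  by rewrite hX // subrr mul0r.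
have MX : \sum_(x <- Z) weighting t Z x * h x = Mag t X.
  under eq_bigr => x _ do rewrite mulr_sumr.
  rewrite exchange_big /= MagE.
  transitivity (\sum_(y <- Z) 1 * weighting t X y).
    rewrite big_seq [RHS]big_seq; apply: eq_bigr => y yZ.
    rewrite -(weightingP yZ) mulr_suml; apply: eq_bigr => x _.
    by rewrite simC; ring.
  by rewrite sum_weighting_sub //; apply: eq_bigr => y _; rewrite mul1r.
rewrite -MX MagE -[LHS]subr0 -[X in _ - X]X0 -!sumrB.
by apply: eq_bigr => x _; rewrite /c; ring.
Qed.

Lemma Mag_le X Z : (X `<=` Z)%fset -> Mag t X <= Mag t Z.
Proof.
by move=> XZ; rewrite -subr_ge0 Mag_subE //; exact: (sim_posdef _ _).1.
Qed.

Lemma eq_Mag_weighting X Z x : (X `<=` Z)%fset -> Mag t Z = Mag t X ->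
  weighting t Z x = weighting t X x.
Proof.
move=> XZ E; have [xZ|xZ] := boolP (x \in Z); last first.
  by rewrite !weighting_out //; apply: contra xZ; exact: (fsubsetP XZ).
apply/eqP; rewrite -subr_eq0; apply/eqP.
have [_ QE] := sim_posdef Z (fun x => weighting t Z x - weighting t X x).
by apply: QE => //; rewrite -Mag_subE // E subrr.
Qed.

(** * Symmetry, non-negativity and zero set of the magnitude distance *)

Lemma dMagC X Y : dMag t X Y = dMag t Y X.
Proof. by rewrite /dMag fsetUC; ring. Qed.

Lemma dMag_ge0 X Y : 0 <= dMag t X Y.
Proof.
have := Mag_le (fsubsetUl X Y); have := Mag_le (fsubsetUr X Y).
by rewrite /dMag; lra.
Qed.

(** Dropping the points of zero weight leaves the equations at the other points intact, so
    uniqueness applies. Hence the support of a weighting determines the weighting. *)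
Lemma weighting_support X x :
  weighting t [fset y in X | weighting t X y != 0]%fset x = weighting t X x.
Proof.
set S := [fset y in X | _]%fset.
have inS y : (y \in S) = (weighting t X y != 0).
  rewrite !inE /= andbC; case: eqVneq => //= nz.
  by apply: contraNT nz => /weighting_out ->.
have [xS|] := boolP (x \in S); last first.
  by move=> xS; rewrite (weighting_out xS); move: xS; rewrite inS negbK => /eqP.
apply/esym/weighting_uniq => // y yS.
have yX : y \in X by move: yS; rewrite !inE => /andP[].
rewrite -(weightingP yX); apply: big_fset_incl.
  by apply/fsubsetP => z; rewrite !inE => /andP[].
by move=> z _; rewrite inS negbK => /eqP ->; rewrite mulr0.
Qed.

Lemma dMag_eq0 X Y : dMag t X Y = 0 <-> mag_equiv t X Y.
Proof.
split=> [d0|E].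
  have := Mag_le (fsubsetUl X Y); have := Mag_le (fsubsetUr X Y).
  move=> leY leX; rewrite /dMag in d0.
  (* Both magnitude increments are nonnegative with sum zero, so both vanish and the two weightings
     coincide with that of the union. *)
  have wX x := eq_Mag_weighting x (fsubsetUl X Y) ltac:(lra).
  have wY x := eq_Mag_weighting x (fsubsetUr X Y) ltac:(lra).
  apply/fsetP => x; rewrite !inE /= -wX -wY.
  case: eqVneq => [|nz]; first by rewrite !andbF.
  rewrite !andbT; apply: (@etrans _ _ true); last apply/esym.
    by apply: contraNT nz => /weighting_out; rewrite -wX => ->.
  by apply: contraNT nz => /weighting_out; rewrite -wY => ->.
have wXY x : weighting t X x = weighting t Y x.
  by rewrite -(weighting_support X) E weighting_support.
(* The common weighting satisfies the equations at the points of [X] and at those of [Y], so it is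
   the weighting of the union. *)
have wP : is_weighting (X `|` Y)%fset (weighting t X).
  move=> x; rewrite in_fsetU => /orP[xX|xY].
    by rewrite sum_weighting_sub ?fsubsetUl // weightingP.
  under eq_bigr => y _ do rewrite wXY.
  by rewrite sum_weighting_sub ?fsubsetUr // weightingP.
have MX : Mag t (X `|` Y)%fset = Mag t X.
  rewrite (is_weighting_Mag wP) MagE; apply/esym/big_fset_incl.
    exact: fsubsetUl.
  by move=> x _ /weighting_out.
have MY : Mag t (X `|` Y)%fset = Mag t Y.
  rewrite (is_weighting_Mag wP) MagE; under [RHS]eq_bigr do rewrite -wXY.
  apply/esym/big_fset_incl; first exact: fsubsetUr.
  by move=> x _ /weighting_out; rewrite -wXY.
by rewrite /dMag -{1}MX -MY MX; ring.
Qed.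

End Magnitude.

(** * Failure of the triangle inequality in dimension at least two *)

(* The four-point configuration [(+-4l, 0)], [(0, +-3l)] has sides 5l and
   diagonals 8l and 6l, so its similarities are powers of [q = exp (- t l)].
   Conditionally on the short diagonal the two other points are negatively
   correlated as soon as [1 + q ^+ 6 < 2 * q ^+ 2]. *)
Section Rhombus.
Context {R : realType} {D : nat} (t : R) (t_gt0 : 0 < t).

Definition ppt (a b : R) : 'rV[R]_D.+2 :=
  \row_i (if i == 0 then a else if i == 1 then b else 0).

Lemma enorm_ppt a b a' b' r : 0 <= r ->
  (a - a') ^+ 2 + (b - b') ^+ 2 = r ^+ 2 -> enorm (ppt a b - ppt a' b') = r.
Proof.
move=> r0 rE; rewrite /enorm !big_ord_recl big1 => [|i _].
  by rewrite !mxE /= addr0 rE sqrtr_sqr ger0_norm.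
by rewrite !mxE /= subrr expr0n.
Qed.

(** Here [1 + q ^+ 6] is about 1.53 while [2 * q ^+ 2] is 1.62. The unit length [l] is tuned to [t]
    so that [exp (- t l) = q] at every scale. *)
Let q : R := 9 / 10.
Let l : R := - ln q / t.

Lemma sim_ppt a b a' b' n :
  (a - a') ^+ 2 + (b - b') ^+ 2 = n%:R ^+ 2 ->
  sim t (ppt (a * l) (b * l)) (ppt (a' * l) (b' * l)) = q ^+ n.
Proof.
move=> E; have q0 : 0 < q by rewrite /q; lra.
have l0 : 0 <= l.
  apply: divr_ge0; last exact: ltW.
  by rewrite oppr_ge0 ln_le0 // /q; lra.
have nl0 : 0 <= n%:R * l by exact: mulr_ge0.
rewrite /sim (enorm_ppt nl0); last first.
  by rewrite exprMn -E; ring.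
have -> : - (t * (n%:R * l)) = ln q * n%:R.
  by rewrite /l; field; rewrite lt0r_neq0.
by rewrite expRM_natr lnK.
Qed.

(** Equal points have similarity 1, whereas [q ^+ n < 1] for positive [n]. *)
Lemma ppt_neq a b a' b' n : (0 < n)%N ->
  (a - a') ^+ 2 + (b - b') ^+ 2 = n%:R ^+ 2 ->
  ppt (a * l) (b * l) != ppt (a' * l) (b' * l).
Proof.
move=> n0 /sim_ppt E; apply/eqP => H; move: E.
have /enormB_eq0 e0 := H; rewrite /sim e0 mulr0 oppr0 expR0.
have : q ^+ n < 1 by rewrite exprn_ilt1 -?lt0n //; rewrite /q; lra.
by move=> /[swap] <-; rewrite ltxx.
Qed.

Let a1 := ppt (4 * l) (0 * l).
Let a2 := ppt (-4 * l) (0 * l).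
Let b1 := ppt (0 * l) (3 * l).
Let b2 := ppt (0 * l) (-3 * l).

Let A := q ^+ 8.
Let B := q ^+ 6.
Let K := q ^+ 5.

Lemma sim_aa : sim t a1 a2 = A. Proof. by apply: sim_ppt; ring. Qed.
Lemma sim_bb : sim t b1 b2 = B. Proof. by apply: sim_ppt; ring. Qed.
Lemma sim_ab a b : a \in [:: a1; a2] -> b \in [:: b1; b2] -> sim t a b = K.
Proof.
rewrite !inE => /orP[] /eqP -> /orP[] /eqP ->; apply: sim_ppt; ring.
Qed.

Lemma rhombus_uniq : uniq [:: a1; a2; b1; b2].
Proof.
rewrite /= !inE !negb_or; do ![apply/andP; split] => //.
- by apply: (@ppt_neq _ _ _ _ 8) => //; ring.
- by apply: (@ppt_neq _ _ _ _ 5) => //; ring.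
- by apply: (@ppt_neq _ _ _ _ 5) => //; ring.
- by apply: (@ppt_neq _ _ _ _ 5) => //; ring.
- by apply: (@ppt_neq _ _ _ _ 5) => //; ring.
- by apply: (@ppt_neq _ _ _ _ 6) => //; ring.
Qed.

Let Y : {fset 'rV[R]_D.+2} := (b1 |` [fset b2])%fset.

Lemma sumY F : \sum_(y <- Y) F y = F b1 + F b2 :> R.
Proof.
move: rhombus_uniq; rewrite /= !inE !negb_or => /and4P[_ _ nb _].
by rewrite big_fsetU1 ?big_seq_fset1 // inE.
Qed.

Lemma notinY a : a \in [:: a1; a2] -> a \notin Y.
Proof.
move: rhombus_uniq; rewrite /= !inE !negb_or.
case/and4P=> /and3P[_ n11 n12] /andP[n21 n22] _ _.
by case/orP=> /eqP ->; apply/andP; split.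
Qed.

Lemma sumaY a F : a \in [:: a1; a2] ->
  \sum_(y <- (a |` Y)%fset) F y = F a + (F b1 + F b2) :> R.
Proof. by move=> /notinY aY; rewrite big_fsetU1 // sumY. Qed.

Lemma sumaaY F :
  \sum_(y <- (a1 |` (a2 |` Y))%fset) F y = F a1 + (F a2 + (F b1 + F b2)) :> R.
Proof.
rewrite big_fsetU1 ?sumaY ?inE ?eqxx ?orbT //=.
rewrite negb_or; have := @notinY a1; rewrite !inE eqxx => -> //.
by move: rhombus_uniq; rewrite /= !inE !negb_or => /andP[/andP[-> _] _].
Qed.

Lemma MagY : Mag t Y = 2 / (1 + B).
Proof.
have B0 : 0 < 1 + B by rewrite /B /q; lra.
rewrite (@is_weighting_Mag _ _ _ t_gt0 _ (fun=> (1 + B)^-1)).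
  by rewrite sumY; clearbody B; field; rewrite lt0r_neq0.
move=> x; rewrite !inE sumY => /orP[] /eqP ->;
  rewrite ?(simC t b2 b1) sim_diag sim_bb; clearbody B;
  by field; rewrite lt0r_neq0.
Qed.

(** [E3] and [E4] are the determinants of the 2 by 2 systems left by the symmetry of the
    configuration with one or both of [a1], [a2]. The ratio [rho / (1 + B)] is the amount by which
    the potential of the weighting of [Y] falls short of 1 at these points. *)
Let E3 := 1 + B - 2 * K ^+ 2.
Let E4 := (1 + A) * (1 + B) - 4 * K ^+ 2.
Let rho := 1 + B - 2 * K.

Lemma inY y : (y \in Y) = (y \in [:: b1; b2]).
Proof. by rewrite !inE. Qed.

Lemma MagaY a : a \in [:: a1; a2] ->
  Mag t (a |` Y)%fset = 2 / (1 + B) + rho ^+ 2 / ((1 + B) * E3).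
Proof.
move=> ai; have B0 : 1 + B != 0 by rewrite lt0r_neq0 // /B /q; lra.
have E0 : E3 != 0 by rewrite lt0r_neq0 // /E3 /B /K /q; lra.
(* Cramer's rule for [wa + 2 * K * wb = 1] and [K * wa + (1 + B) * wb = 1]. *)
pose w x := if x == a then rho / E3 else (1 - K) / E3.
have wa : w a = rho / E3 by rewrite /w eqxx.
have wb b : b \in [:: b1; b2] -> w b = (1 - K) / E3.
  rewrite -inY /w; case: eqP => // -> /negPn; by rewrite notinY.
have b1i : b1 \in [:: b1; b2] by rewrite inE eqxx.
have b2i : b2 \in [:: b1; b2] by rewrite !inE eqxx orbT.
rewrite (@is_weighting_Mag _ _ _ t_gt0 _ w).
  rewrite sumaY // wa !wb //; clear w wa wb; rewrite /E3 /rho in E0 *.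
  by clearbody B K; field; rewrite E0 B0.
move=> x; rewrite sumaY // wa !wb // in_fset1U inY => /orP[/eqP ->|xb].
  rewrite sim_diag !sim_ab //; clear w wa wb; rewrite /E3 /rho in E0 *.
  by clearbody B K; field.
rewrite (simC t x a) sim_ab //; move: xb; rewrite !inE => /orP[] /eqP ->;
  rewrite ?(simC t b2 b1) sim_diag sim_bb; clear w wa wb;
  rewrite /E3 /rho in E0 *; clearbody B K; by field.
Qed.

Lemma MagaaY : Mag t (a1 |` (a2 |` Y))%fset =
  2 / (1 + B) + 2 * rho ^+ 2 / ((1 + B) * E4).
Proof.
have B0 : 1 + B != 0 by rewrite lt0r_neq0 // /B /q; lra.
have E0 : E4 != 0 by rewrite lt0r_neq0 // /E4 /A /B /K /q; lra.
(* Cramer's rule for [(1 + A) * wa + 2 * K * wb = 1] and [2 * K * wa + (1 + B) * wb = 1]. *)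
pose w x := if x \in [:: a1; a2] then rho / E4 else (1 + A - 2 * K) / E4.
have a1i : a1 \in [:: a1; a2] by rewrite inE eqxx.
have a2i : a2 \in [:: a1; a2] by rewrite !inE eqxx orbT.
have wa a : a \in [:: a1; a2] -> w a = rho / E4 by rewrite /w => ->.
have wb b : b \in [:: b1; b2] -> w b = (1 + A - 2 * K) / E4.
  rewrite -inY /w; case: ifP => // /notinY bY; by rewrite (negbTE bY).
have b1i : b1 \in [:: b1; b2] by rewrite inE eqxx.
have b2i : b2 \in [:: b1; b2] by rewrite !inE eqxx orbT.
rewrite (@is_weighting_Mag _ _ _ t_gt0 _ w).
  rewrite sumaaY (wa _ a1i) (wa _ a2i) (wb _ b1i) (wb _ b2i); clear w wa wb.
  rewrite /E4 /rho in E0 *.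
  by clearbody A B K; field; rewrite E0 B0.
move=> x; rewrite sumaaY (wa _ a1i) (wa _ a2i) (wb _ b1i) (wb _ b2i).
rewrite in_fset1U in_fset1U inY orbA.
case/orP=> [xa|xb].
  have xi : x \in [:: a1; a2] by rewrite !inE.
  rewrite (sim_ab xi b1i) (sim_ab xi b2i) {xi}.
  case/orP: xa => /eqP ->; rewrite ?(simC t a2 a1) sim_diag sim_aa;
    clear w wa wb; rewrite /E4 /rho in E0 *; clearbody A B K; by field.
rewrite (simC t x a1) (simC t x a2) (sim_ab a1i xb) (sim_ab a2i xb).
move: xb; rewrite !inE => /orP[] /eqP ->;
  rewrite ?(simC t b2 b1) sim_diag sim_bb; clear w wa wb;
  rewrite /E4 /rho in E0 *; clearbody A B K; by field.
Qed.

(** For this triple the inequality says that adding both [a1] and [a2] to [Y] gains at most the sum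
    of the separate gains. The joint gain has [E4] where the separate ones have [E3], and [E4] is
    smaller. *)
Lemma dMag_not_triangle :
  ~ (forall X Y Z : {fset 'rV[R]_D.+2},
       dMag t X Z <= dMag t X Y + dMag t Y Z).
Proof.
move=> /(_ (a1 |` Y)%fset Y (a2 |` Y)%fset); rewrite /dMag.
have -> : ((a1 |` Y) `|` (a2 |` Y) = a1 |` (a2 |` Y))%fset.
  by rewrite fsetUACA fsetUid fsetUA.
have -> : ((a1 |` Y) `|` Y = a1 |` Y)%fset by rewrite -fsetUA fsetUid.
have -> : (Y `|` (a2 |` Y) = a2 |` Y)%fset by rewrite fsetUC -fsetUA fsetUid.
rewrite MagaaY MagY !MagaY ?inE ?eqxx ?orbT //.
have B0 : 0 < 1 + B by rewrite /B /q; lra.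
have E40 : 0 < E4 by rewrite /E4 /A /B /K /q; lra.
(* This amounts to [A * (1 + B) < 2 * K ^+ 2], which is [1 + q ^+ 6 < 2 * q ^+ 2] multiplied by
   [q ^+ 8]. *)
have E34 : E4 < E3 by rewrite /E3 /E4 /A /B /K /q; lra.
have r0 : 0 < rho ^+ 2 by rewrite exprn_gt0 // /rho /B /K /q; lra.
have : rho ^+ 2 / ((1 + B) * E3) < rho ^+ 2 / ((1 + B) * E4).
  rewrite ltr_pM2l // ltf_pV2 ?posrE ?mulr_gt0 // ?ltr_pM2l //.
  exact: lt_trans E34.
rewrite -[2 * _ / _]mulrA; set m := 2 / (1 + B).
set u := _ / (_ * E3); set v := _ / (_ * E4); lra.
Qed.

End Rhombus.

Theorem theorem5p2 (R : realType) (D : nat) (t : R) (ht : 0 < t) :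
  (forall X Y : {fset 'rV[R]_D}, dMag t X Y = dMag t Y X) /\
  (forall X Y : {fset 'rV[R]_D}, 0 <= dMag t X Y) /\
  (forall X Y : {fset 'rV[R]_D}, dMag t X Y = 0 <-> mag_equiv t X Y) /\
  ((1 < D)%N ->
     ~ (forall X Y Z : {fset 'rV[R]_D}, dMag t X Z <= dMag t X Y + dMag t Y Z)).
Proof.
split; first exact: dMagC.
split; first exact: dMag_ge0.
split; first exact: dMag_eq0.
by case: D => [|[|D]] // _; exact: dMag_not_triangle.
Qed.
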